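(* Let $*$ be a left-continuous t-norm on the unit interval $[0,1]$. The category $[0,1]_*\text{-}\mathbf{Set}$ of $[0,1]_*$-sets and their morphisms is cartesian closed if and only if $*$ is the minimum t-norm on $[0,1]$, i.e. $p*q=p\wedge q=\min\{p,q\}$ for all $p,q\in[0,1]$.
   Context: A left-continuous t-norm on $[0,1]$ is a binary operation $*$ on $[0,1]$ such that $([0,1],*,1)$ is a commutative monoid and $*$ preserves arbitrary suprema in each variable: $p*\bigvee_{i\in I}q_i=\bigvee_{i\in I}(p*q_i)$ and $(\bigvee_{i\in I}p_i)*q=\bigvee_{i\in I}(p_i*q)$. Its residual $\to$ is determined by $p*q\leq r\iff q\leq p\to r$. Write $[0,1]_*$ for $[0,1]$ equipped with $*$. A $[0,1]_*$-set is a set $X$ with a map $\alpha\colon X\times X\to[0,1]$ such that for all $x,y,z\in X$: (S1) $\alpha(x,y)=\alpha(x,x)*(\alpha(x,x)\to\alpha(x,y))=\alpha(y,y)*(\alpha(y,y)\to\alpha(x,y))$; (S2) $\alpha(x,y)=\alpha(y,x)$; (S3) $\alpha(y,z)*(\alpha(y,y)\to\alpha(x,y))\leq\alpha(x,z)$. A distributor $\phi\colon(X,\alpha)\to(Y,\beta)$ of $[0,1]_*$-sets is a function $\phi\colon X\times Y\to[0,1]$ such that for all $x,x'\in X$, $y,y'\in Y$: (M1) $\phi(x,y)=\alpha(x,x)*(\alpha(x,x)\to\phi(x,y))=\beta(y,y)*(\beta(y,y)\to\phi(x,y))$; (M2) $(\beta(y,y)\to\beta(y,y'))*\phi(x,y)*(\alpha(x,x)\to\alpha(x',x))\leq\phi(x',y')$.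 The composite of $\phi\colon(X,\alpha)\to(Y,\beta)$ and $\psi\colon(Y,\beta)\to(Z,\gamma)$ is $(\psi\circ\phi)(x,z)=\bigvee_{y\in Y}\psi(y,z)*(\beta(y,y)\to\phi(x,y))$; the identity distributor on $(X,\alpha)$ is $\alpha$; distributors are ordered pointwise; the opposite $\phi^{\circ}\colon(Y,\beta)\to(X,\alpha)$ is $\phi^{\circ}(y,x)=\phi(x,y)$. A morphism $\phi\colon(X,\alpha)\to(Y,\beta)$ of $[0,1]_*$-sets is a distributor which is a left adjoint (its right adjoint is then necessarily $\phi^\circ$); equivalently, a distributor satisfying (M3) $\phi\circ\phi^{\circ}\leq\beta$ and (M4) $\alpha\leq\phi^{\circ}\circ\phi$. The category $[0,1]_*\text{-}\mathbf{Set}$ has $[0,1]_*$-sets as objects and these morphisms as arrows, with the composition and identities above. *)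

(* Defs.v *)
From mathcomp Require Import all_boot all_order all_algebra.
From mathcomp Require Import interval_inference.
From mathcomp Require Import all_classical all_reals.
Set Implicit Arguments.
Unset Strict Implicit.
Unset Printing Implicit Defensive.
Import Order.TTheory GRing.Theory Num.Theory.

Local Open Scope classical_set_scope.
Local Open Scope ring_scope.

(* The default value of [supremum] is its value on the empty set, so [Isup] is
   the join of the complete lattice [0,1] on every subset, see [IsupP]. *)
Definition Isup (R : realType) (A : set {i01 R}) : {i01 R} :=
  supremum 0%:i01 A.

Section IsupTheory.
Variable R : realType.
Implicit Types (A : set {i01 R}) (p q : {i01 R}).

Lemma i01_ge0 p : 0%:i01 <= p.
Proof. by rewrite -[_ <= _]/(0 <= p%:num). Qed.

Lemma i01_le1 p : p <= 1%:i01.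
Proof. by rewrite -[_ <= _]/(p%:num <= 1). Qed.

Lemma IsupP A : supremums A (Isup A).
Proof.
have [->|A0] := eqVneq A set0.
  rewrite /Isup supremum0; split; first by [].
  by move=> p _; exact: i01_ge0.
rewrite /Isup /supremum (negPf A0); case: xgetP => // /=.
pose B := [set p%:num | p in A].
have [a Aa] : A !=set0 by apply/set0P.
have hB : has_sup B.
  split; first by exists a%:num; exists a.
  by exists 1 => _ [p _ <-]; exact: i01_le1.
have s0 : 0 <= sup B.
  by apply: (@le_trans _ _ a%:num) => //; apply: ub_le_sup; [exact: hB.2|exists a].
have s1 : sup B <= 1.
  by apply: ge_sup; [exact: hB.1|move=> _ [p _ <-]; exact: i01_le1].
move=> /(_ (Itv01 s0 s1)) []; split.
  move=> p Ap; rewrite -[_ <= _]/(p%:num <= sup B).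
  by apply: ub_le_sup; [exact: hB.2|exists p].
move=> p Ap; rewrite -[_ <= _]/(sup B <= p%:num).
by apply: ge_sup; [exact: hB.1|move=> _ [q Aq <-]; exact: Ap].
Qed.

Lemma Isup_ub A p : A p -> p <= Isup A.
Proof. by move=> Ap; have [+ _] := IsupP A; apply. Qed.

Lemma Isup_le A p : (forall q, A q -> q <= p) -> Isup A <= p.
Proof. by move=> Ap; have [_ +] := IsupP A; apply. Qed.

End IsupTheory.

Record lc_tnorm (R : realType) := LcTnorm {
  tmul :> {i01 R} -> {i01 R} -> {i01 R};
  tmulA : forall p q r, tmul p (tmul q r) = tmul (tmul p q) r;
  tmulC : forall p q, tmul p q = tmul q p;
  tmul1 : forall p, tmul 1%:i01 p = p;
  tmul_supr : forall p (A : set {i01 R}),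
    tmul p (Isup A) = Isup [set tmul p q | q in A];
  tmul_supl : forall (A : set {i01 R}) q,
    tmul (Isup A) q = Isup [set tmul p q | p in A];
}.

Definition tres (R : realType) (T : lc_tnorm R) (p r : {i01 R}) : {i01 R} :=
  Isup [set q | T p q <= r].

Declare Scope tnorm_scope.
Delimit Scope tnorm_scope with T.

Section TnormTheory.
Variables (R : realType) (T : lc_tnorm R).
Implicit Types (p q r : {i01 R}).
Local Notation "p * q" := (tmul T p q) : tnorm_scope.
Local Notation "p ~> q" := (tres T p q)
  (at level 55, right associativity) : tnorm_scope.
Local Open Scope tnorm_scope.

Lemma tmulr_mono p q r : q <= r -> p * q <= p * r.
Proof.
move=> qr; have -> : r = Isup [set q; r].
  apply/le_anti/andP; split; first by apply: Isup_ub; right.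
  by apply: Isup_le => _ [|] ->.
by rewrite tmul_supr; apply: Isup_ub; exists q => //; left.
Qed.

Lemma tmul_mono p p' q q' : p <= p' -> q <= q' -> p * q <= p' * q'.
Proof.
move=> pp' qq'; apply: (le_trans (tmulr_mono p qq')).
by rewrite ![_ * q'](tmulC T); exact: tmulr_mono.
Qed.

Lemma tresP p q r : (p * q <= r) = (q <= p ~> r).
Proof.
apply/idP/idP => [pqr|qpr]; first exact: Isup_ub.
apply: (le_trans (tmulr_mono p qpr)); rewrite tmul_supr.
by apply: Isup_le => _ [s + <-].
Qed.

Lemma tres_ev p r : p * (p ~> r) <= r.
Proof. by rewrite tresP. Qed.

Lemma tmulr1 p : p * 1%:i01 = p.
Proof. by rewrite tmulC tmul1. Qed.

Lemma tresxx p : p ~> p = 1%:i01.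
Proof. by apply/le_anti/andP; split; [exact: i01_le1|rewrite -tresP tmulr1]. Qed.

Lemma tres_mul p q : p * (p ~> p * q) = p * q.
Proof.
by apply/le_anti/andP; split; [exact: tres_ev|apply: tmulr_mono; rewrite -tresP].
Qed.

Lemma tres_mono p q r : q <= r -> p ~> q <= p ~> r.
Proof. by move=> qr; rewrite -tresP; exact: le_trans (tres_ev _ _) qr. Qed.

Lemma tres_mulr p q r : (p ~> q) * r <= p ~> q * r.
Proof.
by rewrite -tresP tmulA; apply: tmul_mono => //; exact: tres_ev.
Qed.

Lemma tmulAC p q r : (p * q) * r = (p * r) * q.
Proof. by rewrite -!tmulA (tmulC T q). Qed.

End TnormTheory.

Record tset (R : realType) (T : lc_tnorm R) := TSet {
  tcar :> Type;
  teq : tcar -> tcar -> {i01 R};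
  teq_divl : forall x y, teq x y = T (teq x x) (tres T (teq x x) (teq x y));
  teq_divr : forall x y, teq x y = T (teq y y) (tres T (teq y y) (teq x y));
  teq_sym : forall x y, teq x y = teq y x;
  teq_trans : forall x y z,
    T (teq y z) (tres T (teq y y) (teq x y)) <= teq x z;
}.
Arguments teq {R T t}.

Section Distributor.
Variables (R : realType) (T : lc_tnorm R).
Local Notation "p * q" := (tmul T p q) : tnorm_scope.
Local Notation "p ~> q" := (tres T p q)
  (at level 55, right associativity) : tnorm_scope.
Local Open Scope tnorm_scope.

Record is_distributor (X Y : tset T) (phi : X -> Y -> {i01 R}) : Prop := {
  distr_divl : forall x y, phi x y = teq x x * (teq x x ~> phi x y);
  distr_divr : forall x y, phi x y = teq y y * (teq y y ~> phi x y);
  distr_act : forall x x' y y',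
    (teq y y ~> teq y y') * phi x y * (teq x x ~> teq x' x) <= phi x' y';
}.

Definition dcomp (X Y Z : tset T)
    (psi : Y -> Z -> {i01 R}) (phi : X -> Y -> {i01 R}) : X -> Z -> {i01 R} :=
  fun x z => Isup [set psi y z * (teq y y ~> phi x y) | y in [set: Y]].

Definition dle (X Y : tset T) (phi psi : X -> Y -> {i01 R}) : Prop :=
  forall x y, phi x y <= psi x y.

Definition dadjoint (X Y : tset T)
    (phi : X -> Y -> {i01 R}) (psi : Y -> X -> {i01 R}) : Prop :=
  dle teq (dcomp psi phi) /\ dle (dcomp phi psi) teq.

(* The right adjoint of a distributor is unique, so only its existence is
   required, and parallel morphisms are equal when their functions are. *)
Record tmor (X Y : tset T) := TMor {
  tmor_fun :> X -> Y -> {i01 R};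
  tmor_distr : is_distributor tmor_fun;
  tmor_ladj : exists psi : Y -> X -> {i01 R},
    is_distributor psi /\ dadjoint tmor_fun psi;
}.

Lemma tmor_eq X Y (f g : tmor X Y) : tmor_fun f = tmor_fun g -> f = g.
Proof.
case: f g => [f f1 f2] [g g1 g2] /= fg; move: f1 f2 g1 g2; rewrite fg => *.
by congr TMor; exact: Prop_irrelevance.
Qed.

Lemma teq_distr (X : tset T) : is_distributor (@teq _ _ X).
Proof.
split=> [x y|x y|x x' y y']; [exact: teq_divl|exact: teq_divr|].
rewrite -tmulA; apply: le_trans (_ : (teq y y ~> teq y y') * teq x' y <= _).
  by apply: tmulr_mono; exact: teq_trans.
rewrite tmulC (teq_sym x' y) (teq_sym y y') (teq_sym x' y').
exact: teq_trans.
Qed.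

Lemma div_swap (b u v : {i01 R}) :
  u = b * (b ~> u) -> v = b * (b ~> v) -> v * (b ~> u) = (b ~> v) * u.
Proof.
by move=> bu bv; rewrite {1}bv {2}bu tmulA (tmulC T b).
Qed.

Lemma div_sup (b : {i01 R}) (A : set {i01 R}) :
  (forall p, A p -> p = b * (b ~> p)) -> Isup A = b * (b ~> Isup A).
Proof.
move=> Ab; have -> : Isup A = b * Isup [set b ~> p | p in A].
  rewrite tmul_supr; congr Isup; apply/seteqP; split=> [p Ap|].
    by exists (b ~> p); [exists p|rewrite -Ab].
  by move=> _ [_ [p Ap <-] <-]; rewrite -Ab.
by rewrite tres_mul.
Qed.

Lemma dcomp_distr (X Y Z : tset T) psi phi :
  is_distributor psi -> is_distributor phi ->
  is_distributor (@dcomp X Y Z psi phi).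
Proof.
move=> [psi1 psi2 psi3] [phi1 phi2 phi3]; split.
- move=> x z; apply: div_sup => _ [y _ <-].
  rewrite div_swap // [X in _ * X]phi1.
  by rewrite (tmulC T (_ ~> psi y z)) -tmulA tres_mul.
- move=> x z; apply: div_sup => _ [y _ <-].
  by rewrite [X in X * _]psi2 -tmulA tres_mul.
- move=> x x' z z'; rewrite /dcomp tmul_supr tmul_supl.
  apply: Isup_le => _ [_ [_ [y _ <-] <-] <-].
  apply: le_trans (Isup_ub _); last by exists y.
  rewrite tmulA -tmulA; apply: tmul_mono.
    by apply: le_trans (psi3 y y z z'); rewrite tresxx tmulr1.
  apply: le_trans (tres_mulr _ _ _ _) _; apply: tres_mono.
  by apply: le_trans (phi3 x x' y y); rewrite tresxx tmul1.
Qed.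

Lemma dcompA (X Y Z W : tset T) chi psi phi :
  is_distributor chi -> is_distributor psi -> is_distributor phi ->
  @dcomp X Z W chi (@dcomp X Y Z psi phi) = dcomp (dcomp chi psi) phi.
Proof.
move=> chid psid phid; apply/funext => x; apply/funext => w.
have psiphid := dcomp_distr psid phid.
apply/le_anti/andP; split.
  apply: Isup_le => _ [z _ <-].
  rewrite div_swap; [|exact: distr_divr psiphid _ _|exact: distr_divl chid _ _].
  rewrite tmul_supr; apply: Isup_le => _ [_ [y _ <-] <-].
  apply: le_trans (Isup_ub _); last by exists y.
  rewrite tmulA; apply: tmul_mono => //.
  rewrite -div_swap; [|exact: distr_divr psid _ _|exact: distr_divl chid _ _].
  by apply: Isup_ub; exists z.
apply: Isup_le => _ [y _ <-].
rewrite tmul_supl; apply: Isup_le => _ [_ [z _ <-] <-].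
apply: le_trans (Isup_ub _); last by exists z.
rewrite -tmulA; apply: tmulr_mono.
apply: le_trans (tres_mulr _ _ _ _) _; apply: tres_mono.
by apply: Isup_ub; exists y.
Qed.

Lemma dcompf1 (X Y : tset T) (phi : X -> Y -> {i01 R}) :
  is_distributor phi -> dcomp phi (@teq _ _ X) = phi.
Proof.
move=> [phi1 phi2 phi3]; apply/funext => x; apply/funext => y.
apply/le_anti/andP; split.
  apply: Isup_le => _ [z _ <-].
  by apply: le_trans (phi3 z x y y); rewrite tresxx tmul1.
by apply: Isup_ub; exists x => //; rewrite tresxx tmulr1.
Qed.

Lemma dcomp1f (X Y : tset T) (phi : X -> Y -> {i01 R}) :
  is_distributor phi -> dcomp (@teq _ _ Y) phi = phi.
Proof.
move=> [phi1 phi2 phi3]; apply/funext => x; apply/funext => y.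
apply/le_anti/andP; split.
  apply: Isup_le => _ [z _ <-]; rewrite div_swap //; last exact: teq_divl.
  by apply: le_trans (phi3 x x z y); rewrite tresxx tmulr1.
by apply: Isup_ub; exists y => //; rewrite -phi2.
Qed.

Lemma dcomp_mono (X Y Z : tset T) (psi psi' : Y -> Z -> {i01 R})
    (phi phi' : X -> Y -> {i01 R}) :
  dle psi psi' -> dle phi phi' -> dle (dcomp psi phi) (dcomp psi' phi').
Proof.
move=> le1 le2 x z; apply: Isup_le => _ [y _ <-].
apply: le_trans (Isup_ub _); last by exists y.
by apply: tmul_mono => //; exact: tres_mono.
Qed.

Lemma teq_ladj (X : tset T) : exists psi : X -> X -> {i01 R},
  is_distributor psi /\ dadjoint (@teq _ _ X) psi.
Proof.
have tX := teq_distr X; exists teq; split=> //.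
by split; rewrite dcompf1 // => x y.
Qed.

Lemma dcomp_ladj (X Y Z : tset T) (g : tmor Y Z) (f : tmor X Y) :
  exists psi : Z -> X -> {i01 R},
    is_distributor psi /\ dadjoint (dcomp g f) psi.
Proof.
case: f g => [f fd [f' [f'd [f1 f2]]]] [g gd [g' [g'd [g1 g2]]]] /=.
exists (dcomp f' g'); split; first exact: dcomp_distr.
have rxx (A B : tset T) (h : A -> B -> {i01 R}) : dle h h by move=> ? ?.
have trd (A B : tset T) (h k l : A -> B -> {i01 R}) :
    dle h k -> dle k l -> dle h l.
  by move=> hk kl a b; exact: le_trans (hk a b) (kl a b).
split.
  rewrite dcompA //; last exact: dcomp_distr.
  rewrite -(dcompA f'd g'd gd); apply: trd f1 _.
  apply: dcomp_mono => //; rewrite -{1}[f'](dcompf1 f'd).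
  exact: dcomp_mono.
rewrite dcompA //; last exact: dcomp_distr.
rewrite -(dcompA gd fd f'd); apply: trd g2.
apply: dcomp_mono => //; rewrite -{2}[g](dcompf1 gd).
exact: dcomp_mono.
Qed.

Definition tmor_id (X : tset T) : tmor X X := TMor (teq_distr X) (teq_ladj X).

Definition tmor_comp (X Y Z : tset T) (g : tmor Y Z) (f : tmor X Y) :
  tmor X Z := TMor (dcomp_distr (tmor_distr g) (tmor_distr f)) (dcomp_ladj g f).

Lemma tmor_compA (X Y Z W : tset T)
    (h : tmor Z W) (g : tmor Y Z) (f : tmor X Y) :
  tmor_comp h (tmor_comp g f) = tmor_comp (tmor_comp h g) f.
Proof. by apply: tmor_eq; apply: dcompA; exact: tmor_distr. Qed.

Lemma tmor_comp1f (X Y : tset T) (f : tmor X Y) : tmor_comp (tmor_id Y) f = f.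
Proof. by apply: tmor_eq; apply: dcomp1f; exact: tmor_distr. Qed.

Lemma tmor_compf1 (X Y : tset T) (f : tmor X Y) : tmor_comp f (tmor_id X) = f.
Proof. by apply: tmor_eq; apply: dcompf1; exact: tmor_distr. Qed.

End Distributor.

Record category := Category {
  cob :> Type;
  chom : cob -> cob -> Type;
  cid : forall A, chom A A;
  ccomp : forall A B C, chom B C -> chom A B -> chom A C;
  ccompA : forall A B C D (h : chom C D) (g : chom B C) (f : chom A B),
    ccomp h (ccomp g f) = ccomp (ccomp h g) f;
  ccomp1f : forall A B (f : chom A B), ccomp (cid B) f = f;
  ccompf1 : forall A B (f : chom A B), ccomp f (cid A) = f;
}.

Record finite_products (C : category) := FiniteProducts {
  cterm : C;
  cbang : forall A, chom A cterm;
  cbang_uniq : forall A (f : chom A cterm), f = cbang A;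
  cprod : C -> C -> C;
  cfst : forall A B, chom (cprod A B) A;
  csnd : forall A B, chom (cprod A B) B;
  cpair : forall Z A B, chom Z A -> chom Z B -> chom Z (cprod A B);
  cfst_pair : forall Z A B (f : chom Z A) (g : chom Z B),
    ccomp (cfst A B) (cpair f g) = f;
  csnd_pair : forall Z A B (f : chom Z A) (g : chom Z B),
    ccomp (csnd A B) (cpair f g) = g;
  cpair_uniq : forall Z A B (h : chom Z (cprod A B)),
    h = cpair (ccomp (cfst A B) h) (ccomp (csnd A B) h);
}.

Definition cprod_mapl (C : category) (P : finite_products C) (Z E A : C)
    (g : chom Z E) : chom (cprod P Z A) (cprod P E A) :=
  cpair P (ccomp g (cfst P Z A)) (csnd P Z A).

Definition is_exponential (C : category) (P : finite_products C) (A B E : C)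
    (ev : chom (cprod P E A) B) : Prop :=
  forall (Z : C) (f : chom (cprod P Z A) B),
    exists! g : chom Z E, ccomp ev (cprod_mapl P A g) = f.

Definition cartesian_closed (C : category) : Prop :=
  exists P : finite_products C, forall A B : C,
    exists (E : C) (ev : chom (cprod P E A) B), is_exponential ev.

Definition tset_category (R : realType) (T : lc_tnorm R) : category :=
  @Category (tset T) (@tmor R T) (@tmor_id R T) (@tmor_comp R T)
    (@tmor_compA R T) (@tmor_comp1f R T) (@tmor_compf1 R T).

(* Main.v *)
Require Import Defs.
From mathcomp Require Import all_boot all_order all_algebra.
From mathcomp Require Import interval_inference.
From mathcomp Require Import all_classical all_reals.
Import Order.TTheory GRing.Theory Num.Theory.
Local Open Scope ring_scope.
Set Implicit Arguments.
Unset Strict Implicit.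
Unset Printing Implicit Defensive.

(* If [p * p = p] for all [p], then [0,1]_*-sets are sets valued in the complete
   Heyting algebra [0,1], and the exponential of [A] and [B] is the set of
   partial morphisms from [A] to [B] with the largest extent of agreement as
   equality.

   Conversely, let [t * t < t], let [c < t] be the largest idempotent below
   [t], and let [E] and [Y] be two global points with equality [t] and [c]
   respectively.  Let [A] consist of a global point [u] and a point [y] of
   extent [t] with equality [t] to [u].  The two constant morphisms [E -> Y],
   composed with [A x E -> E], have transposes [a, b : A -> Y^E].  A point of
   extent [s] of [y x E] forces [s] to be idempotent, hence [s <= c], where the
   points of [Y] agree; so [a] and [b] coincide at [y].  Therefore [a(u)] and
   [b(u)] are equal to degree at least [t], and define a morphism [E -> Y^E]
   whose evaluation along the diagonal of [E] separates the points of [E] into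
   those of [Y], which forces [t <= c]. *)

Lemma le_Isup_image (R : realType) (I : Type) (F : I -> {i01 R}) i r :
  r <= F i -> r <= Isup [set F j | j in [set: I]]%classic.
Proof. by move=> rF; apply: (le_trans rF); apply: Isup_ub; exists i. Qed.
Arguments le_Isup_image {R I F} i {r}.

(** * Right adjoints and morphisms over an arbitrary t-norm *)

Section Morphisms.
Local Open Scope classical_set_scope.
Context {R : realType} {T : lc_tnorm R}.
Local Notation "p * q" := (tmul T p q) : tnorm_scope.
Local Notation "p ~> q" := (tres T p q)
  (at level 55, right associativity) : tnorm_scope.
Local Open Scope tnorm_scope.
Implicit Types p q r s t : {i01 R}.

Lemma tmul_lel p q : p * q <= p.
Proof. by rewrite -[leRHS](tmulr1 T); apply: tmulr_mono; exact: i01_le1. Qed.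

Lemma tmul_ler p q : p * q <= q.
Proof. by rewrite tmulC; exact: tmul_lel. Qed.

Lemma tres1 r : 1%:i01 ~> r = r.
Proof.
apply/le_anti/andP; split; last by rewrite -tresP tmul1.
by rewrite -[leLHS](tmul1 T); exact: tres_ev.
Qed.

(** By [tres_mul], the equation [r = p * (p ~> r)] says that [p] divides [r]; (S1) and (M1) have
    this form. *)
Lemma tdiv_le {p r} : r = p * (p ~> r) -> r <= p.
Proof. by move=> ->; exact: tmul_lel. Qed.

Lemma tdiv_mul {p r} q : r = p * (p ~> r) -> r * q = p * (p ~> r * q).
Proof. by move=> e; rewrite e -tmulA tres_mul. Qed.

Section AdjointPoints.
Context {Y : tset T}.
Implicit Types f g : Y -> {i01 R}.

(* Composites [g o f] through different points of [Y] lie on the chain [0,1],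
   so the square of their join is the join of their squares, and
   the square of each is at most [f^o o f]. *)
Lemma adjoint_point_total p f g :
  (forall y, f y = p * (p ~> f y)) -> (forall y, g y = p * (p ~> g y)) ->
  (forall y, f y = teq y y * (teq y y ~> f y)) ->
  (forall y, g y = teq y y * (teq y y ~> g y)) ->
  p <= Isup [set g y * (teq y y ~> f y) | y in [set: Y]] ->
  p <= Isup [set f y * (teq y y ~> f y) | y in [set: Y]].
Proof.
move=> fp gp fb gb tot.
pose tau y := g y * (teq y y ~> f y).
have taup y : tau y = p * (p ~> tau y) by exact: tdiv_mul.
pose S := Isup [set tau y | y in [set: Y]].
have tau_sq y : tau y * (p ~> tau y) <= f y * (teq y y ~> f y).
  rewrite {1}/tau (div_swap (fb y) (gb y)) (tmulC T _ (f y)) -tmulA.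
  apply: tmulr_mono; rewrite -tresP tmulA -gb (div_swap (taup y) (gp y)).
  rewrite /tau (div_swap (fb y) (gb y)).
  exact: le_trans (tmul_ler _ _) (tmul_ler _ _).
(* Squares are taken relative to [p]: from [p <= S] follows [p = p * (p ~> p) <= S * (p ~> S)]. *)
rewrite -[leLHS](tmulr1 T) -(tresxx T p).
apply: le_trans (tmul_mono T tot (tres_mono T p tot)) _.
rewrite -/S {1}/S tmul_supl; apply: Isup_le => _ [_ [y _ <-] <-].
rewrite taup (tmulC T p) -tmulA.
move: (tres_ev T p S) => evS. apply: (le_trans (tmulr_mono T _ evS)).
rewrite {1}/S tmul_supr; apply: Isup_le => _ [_ [y' _ <-] <-].
rewrite tmulC; case/orP: (le_total (tau y) (tau y')) => le_tau.
  apply: (le_Isup_image y').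
  by apply: le_trans (tau_sq y'); apply: tmulr_mono; exact: tres_mono.
apply: (le_Isup_image y).
by apply: le_trans (tau_sq y); exact: tmul_mono.
Qed.

(** The cover of [p] from [adjoint_point_total] involves [f] alone. Multiplied by [p ~> g y'], each
    of its terms contains [f y * (p ~> g y') <= teq y y'], along which the other factor [f y] is
    transported to [f y']. *)
Lemma adjoint_point_le p f g :
  (forall y, f y = p * (p ~> f y)) -> (forall y, g y = p * (p ~> g y)) ->
  (forall y, f y = teq y y * (teq y y ~> f y)) ->
  (forall y, g y = teq y y * (teq y y ~> g y)) ->
  (forall y y', f y * (teq y y ~> teq y y') <= f y') ->
  (forall y y', f y * (p ~> g y') <= teq y y') ->
  p <= Isup [set g y * (teq y y ~> f y) | y in [set: Y]] ->
  forall y, g y <= f y.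
Proof.
move=> fp gp fb gb fact sv tot y'; rewrite gp.
have le_p := adjoint_point_total fp gp fb gb tot.
apply: le_trans (tmul_mono T le_p (lexx _)) _.
rewrite tmul_supl; apply: Isup_le => _ [_ [y _ <-] <-].
apply: le_trans (fact y y'); rewrite -tmulA; apply: tmulr_mono.
by apply: le_trans (tres_mulr _ _ _ _) _; exact: tres_mono.
Qed.

End AdjointPoints.

(** For fixed [x], [adjoint_point_le] gives both inequalities, since [div_swap] makes its hypotheses
    symmetric in [phi x] and [psi ^~ x]. *)
Lemma tmor_ladj_opp {X Y : tset T} (phi : tmor X Y) psi :
  is_distributor psi -> dadjoint phi psi -> psi = fun y x => phi x y.
Proof.
case: (tmor_distr phi) => f1 f2 f3 [g1 g2 g3] [tot sv].
apply/funext => y0; apply/funext => x.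
have sv' y y' : phi x y * (teq x x ~> psi y' x) <= teq y y'.
  rewrite teq_sym; apply: le_trans (sv y' y).
  by apply: Isup_ub; exists x.
have fact y y' : phi x y * (teq y y ~> teq y y') <= phi x y'.
  by apply: le_trans (f3 x x y y'); rewrite tresxx tmulr1 tmulC.
have gact y y' : psi y x * (teq y y ~> teq y y') <= psi y' x.
  by apply: le_trans (g3 y y' x x); rewrite tresxx tmul1 teq_sym.
apply/le_anti/andP; split.
  have tot_x := tot x x.
  by apply: (@adjoint_point_le Y (teq x x) (phi x) (psi ^~ x)).
apply: (@adjoint_point_le Y (teq x x) (psi ^~ x) (phi x)) => //.
  move=> y y'; rewrite div_swap // tmulC teq_sym; exact: sv'.
apply: le_trans (tot x x) _; apply: Isup_le => _ [y _ <-].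
by rewrite div_swap // tmulC; apply: Isup_ub; exists y.
Qed.

Section MorphismBasics.
Context {X Y : tset T}.
Implicit Types phi : tmor X Y.

Lemma tmor_lel phi x y : phi x y <= teq x x.
Proof. exact: tdiv_le (distr_divl (tmor_distr phi) x y). Qed.

Lemma tmor_ler phi x y : phi x y <= teq y y.
Proof. exact: tdiv_le (distr_divr (tmor_distr phi) x y). Qed.

Lemma tmor_actl phi x x' y : phi x y * (teq x x ~> teq x x') <= phi x' y.
Proof.
have := distr_act (tmor_distr phi) x x' y y.
by rewrite tresxx tmul1 (teq_sym x').
Qed.

Lemma tmor_actr phi x y y' : (teq y y ~> teq y y') * phi x y <= phi x y'.
Proof.
by have := distr_act (tmor_distr phi) x x y y'; rewrite tresxx tmulr1.
Qed.

(** With the right adjoint identified as the opposite, the counit becomes (M3); [tmor_tot] is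
    likewise the diagonal of (M4). *)
Lemma tmor_sv phi x y y' : phi x y * (teq x x ~> phi x y') <= teq y y'.
Proof.
have [psi [psid adj]] := tmor_ladj phi.
have e := tmor_ladj_opp psid adj; case: adj => _ sv.
rewrite teq_sym; apply: le_trans (sv y' y).
by apply: Isup_ub; exists x => //; rewrite e.
Qed.

Lemma tmor_tot phi x :
  teq x x <= Isup [set phi x y * (teq y y ~> phi x y) | y in [set: Y]].
Proof.
have [psi [psid adj]] := tmor_ladj phi.
have e := tmor_ladj_opp psid adj; case: adj => tot _.
by have := tot x x; rewrite /dcomp e.
Qed.

(** (M4) on the diagonal suffices: the factor [teq x x ~> teq x x'] turns [teq x x] into [teq x x'],
    and the action moves [phi x y] to [phi x' y]. *)
Lemma tmor_ladj_intro (phi : X -> Y -> {i01 R}) :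
  is_distributor phi ->
  (forall x y y', phi x y * (teq x x ~> phi x y') <= teq y y') ->
  (forall x,
    teq x x <= Isup [set phi x y * (teq y y ~> phi x y) | y in [set: Y]]) ->
  exists psi : Y -> X -> {i01 R}, is_distributor psi /\ dadjoint phi psi.
Proof.
move=> [f1 f2 f3] sv tot; exists (fun y x => phi x y); split.
  split=> [y x|y x|y y' x x']; [exact: f2|exact: f1|].
  apply: le_trans (f3 x x' y y'); rewrite (teq_sym x' x) (teq_sym y' y).
  by rewrite tmulC [X in _ * X]tmulC tmulA.
split=> [x x'|y' y]; last first.
  by apply: Isup_le => _ [x _ <-]; rewrite teq_sym.
rewrite teq_divl; apply: le_trans (tmul_mono T (tot x) (lexx _)) _.
rewrite tmul_supl; apply: Isup_le => _ [_ [y _ <-] <-].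
apply: (le_Isup_image y).
rewrite tmulAC; apply: tmul_mono => //.
by have := f3 x x' y y; rewrite tresxx tmul1 (teq_sym x').
Qed.

End MorphismBasics.

Lemma dcomp_ge {X Y Z : tset T} (g : tmor Y Z) (f : tmor X Y) x y z :
  g y z * f x y <= dcomp g f x z.
Proof.
apply: (le_Isup_image y).
by apply: tmulr_mono; rewrite -tresP; exact: tmul_ler.
Qed.

Section FunctionMorphism.
Context {X Y : tset T} (f : X -> Y).
Hypothesis f_ext : forall x, teq (f x) (f x) = teq x x.
Hypothesis f_eq : forall x x', teq x x' <= teq (f x) (f x').

Lemma tmor_of_distr : is_distributor (fun x y => teq (f x) y).
Proof.
split=> [x y|x y|x x' y y']; first by rewrite -f_ext; exact: teq_divl.
  exact: teq_divr.
have [_ _ act] := teq_distr Y; apply: le_trans (act (f x) (f x') y y').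
by apply: tmulr_mono; rewrite f_ext; apply: tres_mono; exact: f_eq.
Qed.

Lemma tmor_of_ladj : exists psi : Y -> X -> {i01 R},
  is_distributor psi /\ dadjoint (fun x y => teq (f x) y) psi.
Proof.
apply: tmor_ladj_intro => [|x y y'|x]; first exact: tmor_of_distr.
  by rewrite -f_ext (teq_sym (f x) y') (teq_sym y); exact: teq_trans.
apply: (le_Isup_image (f x)).
by rewrite tresxx tmulr1 f_ext.
Qed.

(** The graph of [f]; precomposition with it is substitution, see [tmor_comp_of]. *)
Definition tmor_of : tmor X Y := TMor tmor_of_distr tmor_of_ladj.

Lemma tmor_comp_of {Z : tset T} (g : tmor Y Z) x :
  tmor_comp g tmor_of x = g (f x).
Proof.
apply/funext => z.
by have := dcompf1 (tmor_distr g) => /(congr1 (fun h => h (f x) z)).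
Qed.

End FunctionMorphism.

End Morphisms.

(** * Finite products and exponentials in an arbitrary category *)

Section Products.
Context {C : category} (P : finite_products C).

Lemma cpair_ext Z A B (h h' : chom Z (cprod P A B)) :
  ccomp (cfst P A B) h = ccomp (cfst P A B) h' ->
  ccomp (csnd P A B) h = ccomp (csnd P A B) h' -> h = h'.
Proof. by move=> e1 e2; rewrite (cpair_uniq h) (cpair_uniq h') e1 e2. Qed.

Lemma cpair_comp Z Z' A B (f : chom Z A) (g : chom Z B) (k : chom Z' Z) :
  ccomp (cpair P f g) k = cpair P (ccomp f k) (ccomp g k).
Proof.
by apply: cpair_ext; rewrite ccompA ?cfst_pair ?csnd_pair.
Qed.

Lemma cprod_mapl_pair Z Z' A B (f : chom Z Z') (g : chom B Z) (k : chom B A) :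
  ccomp (cprod_mapl P A f) (cpair P g k) = cpair P (ccomp f g) k.
Proof. by rewrite cpair_comp -ccompA cfst_pair csnd_pair. Qed.

Lemma cprod_mapl_comp Z Z' Z'' A (g : chom Z' Z'') (f : chom Z Z') :
  cprod_mapl P A (ccomp g f) = ccomp (cprod_mapl P A g) (cprod_mapl P A f).
Proof. by rewrite cprod_mapl_pair /cprod_mapl ccompA. Qed.

Lemma exponential_inj A B E (ev : chom (cprod P E A) B) Z (g g' : chom Z E) :
  is_exponential ev ->
  ccomp ev (cprod_mapl P A g) = ccomp ev (cprod_mapl P A g') -> g = g'.
Proof.
move=> evP; have [k [_ uk]] := evP Z (ccomp ev (cprod_mapl P A g)).
by move=> egg'; rewrite -(uk g) // -(uk g').
Qed.

(** A map that ignores the first variable still does so after reindexing along [f]. This allows two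
    transposes to be compared after restriction to a smaller domain. *)
Lemma exponential_comp A B E (ev : chom (cprod P E A) B) Z Z'
    (g : chom Z E) (f : chom Z' Z) (n : chom A B) :
  ccomp ev (cprod_mapl P A g) = ccomp n (csnd P Z A) ->
  ccomp ev (cprod_mapl P A (ccomp g f)) = ccomp n (csnd P Z' A).
Proof.
by move=> eg; rewrite cprod_mapl_comp ccompA eg -ccompA csnd_pair.
Qed.

(** In terms of elements, [ev (h e, e) = ev (g i, e) = n e], the last step because [g] transposes a
    map that ignores the first variable. *)
Lemma exponential_diag A B E (ev : chom (cprod P E A) B) Z W (h : chom A E)
    (g : chom Z E) (n : chom A B) (i : chom W Z) (e : chom W A) :
  ccomp ev (cprod_mapl P A g) = ccomp n (csnd P Z A) ->
  ccomp h e = ccomp g i ->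
  ccomp (ccomp (ccomp ev (cprod_mapl P A h))
    (cpair P (Defs.cid A) (Defs.cid A))) e = ccomp n e.
Proof.
move=> eg hg; transitivity (ccomp (ccomp ev (cprod_mapl P A g)) (cpair P i e)).
  by rewrite -!ccompA cpair_comp ccomp1f !cprod_mapl_pair hg.
by rewrite eg -ccompA csnd_pair.
Qed.

End Products.

(** * Cartesian closedness forces idempotency *)

Section CartesianClosedIdempotent.
Local Open Scope classical_set_scope.
Context {R : realType} {T : lc_tnorm R}.
Local Notation "p * q" := (tmul T p q) : tnorm_scope.
Local Notation "p ~> q" := (tres T p q)
  (at level 55, right associativity) : tnorm_scope.
Local Open Scope tnorm_scope.
Implicit Types p q r s t : {i01 R}.
Local Notation C := (tset_category T).

Section TwoPoints.
Variables p q r : {i01 R}.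
Hypotheses (pr : r = p * (p ~> r)) (qr : r = q * (q ~> r)).

Definition two_eq (x y : bool) : {i01 R} :=
  if x then if y then p else r else if y then r else q.

Lemma two_eq_divl x y :
  two_eq x y = two_eq x x * (two_eq x x ~> two_eq x y).
Proof. by case: x y => [] [] //=; rewrite tresxx tmulr1. Qed.

Lemma two_eq_sym x y : two_eq x y = two_eq y x.
Proof. by case: x y => [] []. Qed.

Lemma two_eq_divr x y :
  two_eq x y = two_eq y y * (two_eq y y ~> two_eq x y).
Proof. by rewrite two_eq_sym; exact: two_eq_divl. Qed.

Lemma two_eq_trans x y z :
  two_eq y z * (two_eq y y ~> two_eq x y) <= two_eq x z.
Proof.
have rp := tdiv_le pr; have rq := tdiv_le qr.
case: x y z => [] [] [] /=; rewrite ?tresxx ?tmulr1 ?tres_ev //.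
  exact: le_trans (tmul_lel _ _) rp.
exact: le_trans (tmul_lel _ _) rq.
Qed.

Definition two_set : tset T :=
  TSet two_eq_divl two_eq_divr two_eq_sym two_eq_trans.

End TwoPoints.

(** The proof passed to [two_set] fixes the extent of a point: [1] for [tdiv1 r], and the degree of
    equality [r] itself for [tdivxx r]. *)
Lemma tdiv1 r : r = 1%:i01 * (1%:i01 ~> r).
Proof. by rewrite tmul1 tres1. Qed.

Lemma tdivxx r : r = r * (r ~> r).
Proof. by rewrite tresxx tmulr1. Qed.

Definition largest_idem t := Isup [set s | s * s = s /\ s <= t].

(** A join of idempotents is idempotent, as each [s = s * s] lies below the square of the join. *)
Lemma largest_idem_mul t : largest_idem t * largest_idem t = largest_idem t.
Proof.
apply/le_anti; rewrite tmul_lel /=; apply: Isup_le => s [ss st].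
by rewrite -ss; apply: tmul_mono; exact: Isup_ub.
Qed.

(* A chain has no nontrivial finite covers, so a point of extent [s] of a finite
   set of global points forces [s * s = s]. *)
Lemma idem_extent t r (tr : r = 1%:i01 * (1%:i01 ~> r))
  (X : tset T) (f : tmor X (two_set (tdivxx t) (tdivxx t)))
  (g : tmor X (two_set tr tr)) x y :
  largest_idem t * g x y = g x y.
Proof.
set s := teq x x.
have le_st : s <= t.
  apply: le_trans (tmor_tot f x) _; apply: Isup_le => _ [z _ <-].
  apply: le_trans (tmul_lel _ _) _; apply: le_trans (tmor_ler f x z) _.
  by case: z.
have le_ss : s <= s * s.
  apply: le_trans (tmor_tot g x) _; apply: Isup_le => _ [z _ <-].
  have -> : teq z z = 1%:i01 by case: z.
  by rewrite tres1; apply: tmul_mono; exact: tmor_lel.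
have ss : s * s = s by apply/le_anti; rewrite tmul_lel.
rewrite (distr_divl (tmor_distr g) x y) tmulA; congr tmul.
apply/le_anti; rewrite tmul_ler /= -{1}[teq x x]ss.
by apply: tmul_mono => //; exact: Isup_ub.
Qed.

Lemma cartesian_closed_idem : cartesian_closed C -> forall t, t * t = t.
Proof.
move=> [P expo] t; pose c := largest_idem t.
(* Idempotency of [c] then gives [t <= c * c <= t * t]. *)
suff tc : t <= c.
  apply/le_anti; rewrite tmul_lel /=; apply: (le_trans tc).
  by rewrite -[leLHS]largest_idem_mul; apply: tmul_mono;
    apply: Isup_le => s [].
(* An opaque copy of the unit; [one1] supplies its value where extents are compared. *)
have [one one1] : exists p : {i01 R}, p = 1%:i01 by exists 1%:i01.
(* [I1] and [D] are one-point sets up to isomorphism; [I1] picks out global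
   points, and [D] is the point [y] of the header. *)
pose I1 := two_set (tdivxx one) (tdivxx one).
pose D := two_set (tdivxx t) (tdivxx t).
pose A := two_set (tdiv1 t) (tdivxx t).
pose E := two_set (tdiv1 t) (tdiv1 t).
pose Y := two_set (tdiv1 c) (tdiv1 c).
have cst_ext (y : bool) (x : E) : @teq _ _ Y y y = teq x x.
  by case: y x => [] [].
have cst_eq (y : bool) (x x' : E) : teq x x' <= @teq _ _ Y y y.
  by case: y; exact: i01_le1.
pose n (y : bool) : tmor E Y := tmor_of (cst_ext y) (cst_eq y).
have j_ext (x : D) : @teq _ _ A false false = teq x x by case: x.
have j_eq (x x' : D) : teq x x' <= @teq _ _ A false false.
  by case: x x' => [] [].
pose j : tmor D A := tmor_of j_ext j_eq.
have i_ext (x : I1) : @teq _ _ A true true = teq x x.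
  by transitivity one; [rewrite one1|case: x].
have i_eq (x x' : I1) : teq x x' <= @teq _ _ A true true by exact: i01_le1.
pose i : tmor I1 A := tmor_of i_ext i_eq.
have e_ext (y : bool) (x : I1) : @teq _ _ E y y = teq x x.
  by transitivity one; [rewrite one1; case: y|case: x].
have e_eq (y : bool) (x x' : I1) : teq x x' <= @teq _ _ E y y.
  by case: y; exact: i01_le1.
pose e (y : bool) : tmor I1 E := tmor_of (e_ext y) (e_eq y).
have [Z [ev evP]] := expo E Y.
have tr (y : bool) : exists a : tmor A Z,
    ccomp ev (cprod_mapl P E (a : chom (A : C) Z)) =
    ccomp (n y : chom (E : C) Y) (csnd P A E).
  have [a [ea _]] := evP A (ccomp (n y : chom (E : C) Y) (csnd P A E)).
  by exists a.
have [[a ea] [b eb]] := (tr true, tr false).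
have ab : ccomp (a : chom (A : C) Z) (j : chom (D : C) A) =
    ccomp (b : chom (A : C) Z) (j : chom (D : C) A).
  apply: (exponential_inj evP).
  rewrite (exponential_comp (j : chom (D : C) A) ea).
  rewrite (exponential_comp (j : chom (D : C) A) eb).
  apply: tmor_eq; apply/funext => x; apply/funext => w.
  (* [n y z w] is [1] or [c] according to whether [y = w], and by [idem_extent] multiplication by
     [c] fixes the values of [csnd]; so the product does not depend on [y]. *)
  suff n_snd (y : bool) z : n y z w * (teq z z ~> csnd P D E x z) =
      csnd P D E x z.
    congr Isup; apply: eq_imagel => z _.
    exact: etrans (n_snd true z) (esym (n_snd false z)).
  have -> : teq z z = 1%:i01 by case: z.
  rewrite tres1; have := idem_extent (cfst P D E) (csnd P D E) x z.
  by case: y w => [] [] //= _; rewrite tmul1.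
have abf z : a false z = b false z.
  have ab_fun : tmor_comp a j = tmor_comp b j := ab.
  have := congr1 (fun f : tmor D Z => f true z) ab_fun.
  by rewrite !tmor_comp_of.
pose h (x : E) := if x then a true else b true.
have h_div x z : h x z = teq x x * (teq x x ~> h x z).
  by case: x => /=; exact: tdiv1.
(* Passing from [u = true] to [y = false] costs one factor [t]. The way back is free, since the
   extent of [y] equals its equality [t] with [u] and [t ~> t = 1]. The total cost [t], rather than
   [t * t], is what the equality of [E] allows. *)
have at_le z : a true z * t <= b true z.
  apply: (@le_trans _ _ (a false z)).
    by have := tmor_actl a true false z; rewrite /= tres1.
  rewrite abf; have := tmor_actl b false true z.
  by rewrite /= tresxx tmulr1.
have bt_le z : b true z * t <= a true z.
  apply: (@le_trans _ _ (b false z)).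
    by have := tmor_actl b true false z; rewrite /= tres1.
  rewrite -abf; have := tmor_actl a false true z.
  by rewrite /= tresxx tmulr1.
have h_distr : @is_distributor _ _ E Z h.
  split=> [//|x z|x x' z z'].
    by case: x => /=; exact: distr_divr (tmor_distr _) _ _.
  apply: (@le_trans _ _ (h x z' * (teq x x ~> teq x' x))).
    by apply: tmul_mono => //; case: x => /=; exact: tmor_actr.
  by case: x x' => [] []; rewrite /= tres1 ?tmulr1.
have h_ladj : exists psi : Z -> E -> {i01 R},
    is_distributor psi /\ dadjoint h psi.
  apply: tmor_ladj_intro => //.
    case=> z z'; [exact: (tmor_sv a true)|exact: (tmor_sv b true)].
  case; [exact: (tmor_tot a true)|exact: (tmor_tot b true)].
pose hm : tmor E Z := TMor h_distr h_ladj.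
pose m : tmor E Y := ccomp (ccomp ev (cprod_mapl P E (hm : chom (E : C) Z)))
  (cpair P (Defs.cid (E : C)) (Defs.cid (E : C))).
(* At the point [y] of [E], [hm] is the value at [u] of the transpose of the constant [n y]; so [m]
   sends the point [y] of [E] to the point [y] of [Y]. *)
have mE y (g : tmor A Z) : ccomp ev (cprod_mapl P E (g : chom (A : C) Z)) =
    ccomp (n y : chom (E : C) Y) (csnd P A E) ->
    tmor_comp hm (e y) = tmor_comp g i -> m y = n y y.
  move=> eg hg; have : tmor_comp m (e y) = tmor_comp (n y) (e y).
    exact: (exponential_diag eg hg).
  move=> /(congr1 (fun f : tmor I1 Y => f true : Y -> _)).
  by rewrite !tmor_comp_of.
have mt : m true = n true true.
  apply: (mE true a ea); apply: tmor_eq; apply/funext => x.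
  by rewrite !tmor_comp_of.
have mf : m false = n false false.
  apply: (mE false b eb); apply: tmor_eq; apply/funext => x.
  by rewrite !tmor_comp_of.
(* [m] does not decrease equality, which is [t] between the points of [E] and [c] between their
   images. *)
have := tmor_actl m true false true.
by rewrite mt mf /= tres1 tmul1.
Qed.

End CartesianClosedIdempotent.

(** * Idempotent t-norms: Heyting-valued sets and forcing *)

Section IdempotentCartesianClosed.
Local Open Scope classical_set_scope.
Context {R : realType} {T : lc_tnorm R}.
Local Notation "p * q" := (tmul T p q) : tnorm_scope.
Local Notation "p ~> q" := (tres T p q)
  (at level 55, right associativity) : tnorm_scope.
Local Open Scope tnorm_scope.
Implicit Types p q r s t : {i01 R}.
Hypothesis idem : forall p, p * p = p.
Local Notation C := (tset_category T).

(** An idempotent product is the meet, because [r = r * r]. *)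
Lemma le_tmul r p q : (r <= p * q) = (r <= p) && (r <= q).
Proof.
apply/idP/andP => [rpq|[rp rq]].
  by split; apply: (le_trans rpq); [exact: tmul_lel|exact: tmul_ler].
by rewrite -(idem r); exact: tmul_mono.
Qed.

(** Divisibility thus reduces to the order, and (S1) and (M1) to bounds by extents. *)
Lemma tdiv_idem p r : r <= p -> r = p * (p ~> r).
Proof.
move=> rp; apply/le_anti.
by rewrite tres_ev le_tmul rp -tresP tmul_ler.
Qed.

(** This removes the residuals by extents from (S3), (M2) and composites. *)
Lemma tmul_tres p q r : q <= p -> q * (p ~> r) = q * r.
Proof.
move=> qp; apply/le_anti; rewrite !le_tmul !tmul_lel -tresP /=.
apply/andP; split.
  by apply: le_trans (tres_ev T p r); exact: tmul_mono.
by rewrite (le_trans (tmul_ler _ _)) ?tmul_ler.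
Qed.

(* From here on inequalities are proved in Kripke-Joyal style, [r] being the
   stage at which both sides are forced. *)
Lemma Isup_elim (A : set {i01 R}) p r :
  (forall q s, A q -> s <= r -> s <= q -> s <= p) -> r <= Isup A -> r <= p.
Proof.
move=> Ap rA; have -> : r = r * Isup A.
  by apply/le_anti; rewrite le_tmul lexx rA tmul_lel.
rewrite tmul_supr; apply: Isup_le => _ [q Aq <-].
by apply: (Ap q) => //; [exact: tmul_lel|exact: tmul_ler].
Qed.

Section Builders.

Section TSet.
Variables (X : Type) (e : X -> X -> {i01 R}).
Hypotheses (e_lel : forall x y, e x y <= e x x)
  (e_sym : forall x y, e x y = e y x).
Hypothesis e_trans :
  forall x y z r, r <= e x y -> r <= e y z -> r <= e x z.

Let e_ler x y : e x y <= e y y.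
Proof. by rewrite e_sym. Qed.

Let e_divl x y : e x y = e x x * (e x x ~> e x y).
Proof. exact: tdiv_idem. Qed.

Let e_divr x y : e x y = e y y * (e y y ~> e x y).
Proof. exact: tdiv_idem. Qed.

Let e_act x y z : e y z * (e y y ~> e x y) <= e x z.
Proof.
rewrite tmul_tres //; apply: (e_trans (y := y)); first exact: tmul_ler.
exact: tmul_lel.
Qed.

Definition tset_idem : tset T := TSet e_divl e_divr e_sym e_act.

End TSet.

Section TMor.
Variables (X Y : tset T) (f : X -> Y -> {i01 R}).
Hypotheses (f_lel : forall x y, f x y <= teq x x)
  (f_ler : forall x y, f x y <= teq y y).
Hypothesis f_extl :
  forall x x' y r, r <= teq x x' -> r <= f x y -> r <= f x' y.
Hypothesis f_extr :
  forall x y y' r, r <= teq y y' -> r <= f x y -> r <= f x y'.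
Hypothesis f_sv :
  forall x y y' r, r <= f x y -> r <= f x y' -> r <= teq y y'.
Hypothesis f_tot : forall x, teq x x <= Isup [set f x y | y in [set: Y]].

Let f_distr : is_distributor f.
Proof.
split=> [x y|x y|x x' y y']; try exact: tdiv_idem.
rewrite -tmulA tmul_tres // tmulC tmul_tres; last first.
  exact: le_trans (tmul_lel _ _) (f_ler x y).
set r := leLHS; have: r <= r by [].
rewrite {2}/r !le_tmul teq_sym => /andP[/andP[rf rx] ry].
by apply: f_extr ry _; exact: f_extl rx rf.
Qed.

Let f_ladj : exists psi : Y -> X -> {i01 R},
  is_distributor psi /\ dadjoint f psi.
Proof.
apply: tmor_ladj_intro => // [x y y'|x].
  rewrite tmul_tres //; apply: (f_sv (x := x)); first exact: tmul_lel.
  exact: tmul_ler.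
apply: (le_trans (f_tot x)); apply: Isup_le => _ [y _ <-].
by apply: (le_Isup_image y); rewrite tmul_tres // idem.
Qed.

Definition tmor_idem : tmor X Y := TMor f_distr f_ladj.

End TMor.
End Builders.

Lemma teq_lel (X : tset T) (x y : X) : teq x y <= teq x x.
Proof. exact: tdiv_le (teq_divl x y). Qed.

Lemma teq_ler (X : tset T) (x y : X) : teq x y <= teq y y.
Proof. by rewrite teq_sym; exact: teq_lel. Qed.

Lemma teq_trans_idem (X : tset T) (x y z : X) r :
  r <= teq x y -> r <= teq y z -> r <= teq x z.
Proof.
move=> xy yz; apply: le_trans (teq_trans x y z).
by rewrite tmul_tres ?teq_lel // le_tmul yz.
Qed.

Section Elim.
Context {X Y : tset T} (f : tmor X Y).

Lemma tmor_extl x x' y r : r <= teq x x' -> r <= f x y -> r <= f x' y.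
Proof.
move=> rx rf; apply: le_trans (tmor_actl f x x' y).
by rewrite tmul_tres ?tmor_lel // le_tmul rf.
Qed.

Lemma tmor_extr x y y' r : r <= teq y y' -> r <= f x y -> r <= f x y'.
Proof.
move=> ry rf; apply: le_trans (tmor_actr f x y y').
by rewrite tmulC tmul_tres ?tmor_ler // le_tmul rf.
Qed.

Lemma tmor_sv_idem x y y' r : r <= f x y -> r <= f x y' -> r <= teq y y'.
Proof.
move=> ry ry'; apply: le_trans (tmor_sv f x y y').
by rewrite tmul_tres ?tmor_lel // le_tmul ry.
Qed.

Lemma tmor_tot_le x : teq x x <= Isup [set f x y | y in [set: Y]].
Proof.
apply: (le_trans (tmor_tot f x)); apply: Isup_le => _ [y _ <-].
by apply: (le_Isup_image y); exact: tmul_lel.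
Qed.

(** Totality as existential elimination: where [x] exists, a value [y] may be chosen at the cost of
    a smaller stage [s]. *)
Lemma tmor_elim x p r :
  (forall y s, s <= r -> s <= f x y -> s <= p) -> r <= teq x x -> r <= p.
Proof.
move=> fp rx; apply: Isup_elim (le_trans rx (tmor_tot_le x)).
by move=> _ s [y _ <-]; exact: fp.
Qed.

End Elim.

(** A total relation inside a single-valued one equals it: where [g x y] holds, some [f x y'] does,
    hence [g x y'], so [y'] and [y] agree. *)
Lemma tmor_le_eq {X Y : tset T} (f g : tmor X Y) :
  (forall x y, f x y <= g x y) -> f = g.
Proof.
move=> fg; apply: tmor_eq; apply/funext => x; apply/funext => y.
apply/le_anti; rewrite fg /=.
apply: (tmor_elim (f := f) (x := x)); last exact: tmor_lel.
move=> y' s sg sf; apply: (tmor_extr (y := y')) => //.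
by apply: (tmor_sv_idem (f := g) (x := x)) => //; exact: le_trans (fg x y').
Qed.

Lemma tmor_comp_intro {X Y Z : tset T} (g : tmor Y Z) (f : tmor X Y) x y z r :
  r <= g y z -> r <= f x y -> r <= tmor_comp g f x z.
Proof.
by move=> rg rf; apply: le_trans (dcomp_ge g f x y z); rewrite le_tmul rg.
Qed.

Lemma tmor_comp_elim {X Y Z : tset T} (g : tmor Y Z) (f : tmor X Y) x z p r :
  (forall y s, s <= r -> s <= g y z -> s <= f x y -> s <= p) ->
  r <= tmor_comp g f x z -> r <= p.
Proof.
move=> gfp; apply: Isup_elim => _ s [y _ <-] sr; rewrite tmul_tres ?tmor_lel //.
by rewrite le_tmul => /andP[]; exact: gfp.
Qed.

(** * Terminal object and binary products *)

Definition tset_unit : tset T :=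
  @tset_idem unit (fun _ _ => 1%:i01) (fun _ _ => lexx _) (fun _ _ => erefl)
    (fun _ _ _ _ _ _ => i01_le1 _).

Definition tmor_unit (X : tset T) : tmor X tset_unit.
Proof.
apply: (@tmor_idem X tset_unit (fun x _ => teq x x)) => //.
- by move=> x y; exact: i01_le1.
- by move=> x x' _ r rx _; apply: (le_trans rx); exact: teq_ler.
- by move=> *; exact: i01_le1.
- by move=> x; exact: (le_Isup_image tt).
Defined.

Lemma tmor_unit_uniq (X : tset T) (f : tmor X tset_unit) : f = tmor_unit X.
Proof. by apply: tmor_le_eq => x y; exact: tmor_lel. Qed.

Definition tset_prod (X Y : tset T) : tset T.
Proof.
apply: (@tset_idem (X * Y)%type (fun u v => teq u.1 v.1 * teq u.2 v.2)).
- by move=> u v; apply: tmul_mono; exact: teq_lel.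
- by move=> u v; rewrite teq_sym (teq_sym u.2).
- move=> u v w r; rewrite !le_tmul => /andP[uv1 uv2] /andP[vw1 vw2].
  by rewrite (teq_trans_idem uv1 vw1) (teq_trans_idem uv2 vw2).
Defined.

Lemma tset_prod_eq X Y (u v : tset_prod X Y) r :
  (r <= teq u v) = (r <= teq u.1 v.1) && (r <= teq u.2 v.2).
Proof. exact: le_tmul. Qed.

(** The factor [teq u.2 u.2] cuts the value down to the extent of the pair [u]. *)
Definition tmor_fst (X Y : tset T) : tmor (tset_prod X Y) X.
Proof.
apply: (@tmor_idem (tset_prod X Y) X (fun u x => teq u.1 x * teq u.2 u.2)).
- by move=> u x; apply: tmul_mono => //; exact: teq_lel.
- by move=> u x; apply: le_trans (tmul_lel _ _) (teq_ler _ _).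
- move=> u v x r; rewrite tset_prod_eq !le_tmul => /andP[uv1 uv2] /andP[ux _].
  rewrite (le_trans uv2 (teq_ler _ _)) andbT.
  by apply: teq_trans_idem ux; rewrite teq_sym.
- move=> u x y r xy; rewrite !le_tmul => /andP[ux ->].
  by rewrite (teq_trans_idem ux xy).
- move=> u x y r; rewrite !le_tmul => /andP[ux _] /andP[uy _].
  by apply: teq_trans_idem uy; rewrite teq_sym.
- by move=> u; exact: (le_Isup_image u.1).
Defined.

Definition tmor_snd (X Y : tset T) : tmor (tset_prod X Y) Y.
Proof.
apply: (@tmor_idem (tset_prod X Y) Y (fun u y => teq u.1 u.1 * teq u.2 y)).
- by move=> u y; apply: tmul_mono => //; exact: teq_lel.
- by move=> u y; apply: le_trans (tmul_ler _ _) (teq_ler _ _).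
- move=> u v y r; rewrite tset_prod_eq !le_tmul => /andP[uv1 uv2] /andP[_ uy].
  rewrite (le_trans uv1 (teq_ler _ _)) /=.
  by apply: teq_trans_idem uy; rewrite teq_sym.
- move=> u x y r xy; rewrite !le_tmul => /andP[-> uy].
  by rewrite (teq_trans_idem uy xy).
- move=> u x y r; rewrite !le_tmul => /andP[_ ux] /andP[_ uy].
  by apply: teq_trans_idem uy; rewrite teq_sym.
- by move=> u; exact: (le_Isup_image u.2).
Defined.

Definition tmor_pair (Z X Y : tset T) (f : tmor Z X) (g : tmor Z Y) :
  tmor Z (tset_prod X Y).
Proof.
apply: (@tmor_idem Z (tset_prod X Y) (fun z u => f z u.1 * g z u.2)).
- by move=> z u; apply: le_trans (tmul_lel _ _) (tmor_lel _ _ _).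
- by move=> z u; apply: tmul_mono; exact: tmor_ler.
- move=> z z' u r zz'; rewrite !le_tmul => /andP[rf rg].
  by rewrite (tmor_extl zz' rf) (tmor_extl zz' rg).
- move=> z u v r; rewrite tset_prod_eq !le_tmul => /andP[uv1 uv2] /andP[rf rg].
  by rewrite (tmor_extr uv1 rf) (tmor_extr uv2 rg).
- move=> z u v r; rewrite tset_prod_eq !le_tmul => /andP[fu gu] /andP[fv gv].
  by rewrite (tmor_sv_idem fu fv) (tmor_sv_idem gu gv).
- move=> z; apply: (tmor_elim (f := f)) => // x s sz sf.
  apply: (tmor_elim (f := g)) sz => y s' s's sg.
  by apply: (le_Isup_image (x, y)); rewrite le_tmul sg (le_trans s's).
Defined.

Definition tset_products : finite_products C.
Proof.
apply: (@FiniteProducts C tset_unit tmor_unit tmor_unit_uniq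
  tset_prod tmor_fst tmor_snd tmor_pair).
- move=> Z X Y f g; apply: tmor_le_eq => z x.
  apply: tmor_comp_elim (lexx _) => u s _; rewrite !le_tmul.
  by move=> /andP[ux _] /andP[sf _]; exact: tmor_extr ux sf.
- move=> Z X Y f g; apply: tmor_le_eq => z y.
  apply: tmor_comp_elim (lexx _) => u s _; rewrite !le_tmul.
  by move=> /andP[_ uy] /andP[_ sg]; exact: tmor_extr uy sg.
- move=> Z X Y h; apply: tmor_le_eq => z u; rewrite le_tmul.
  have := tmor_ler h z u; rewrite tset_prod_eq => /andP[u1 u2].
  by apply/andP; split; apply: tmor_comp_intro (lexx _); rewrite le_tmul u1 u2.
Defined.

Lemma cprod_maplE (Z E X : tset T) (g : tmor Z E) u v r :
  (r <= (cprod_mapl tset_products X (g : chom (Z : C) E) : tmor _ _) u v) =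
  (r <= g u.1 v.1) && (r <= teq u.2 v.2).
Proof.
rewrite le_tmul; apply/andP/andP => -[rg ru].
  move: ru; rewrite le_tmul => /andP[_ ->]; split=> //.
  apply: tmor_comp_elim rg => z s _ sg; rewrite le_tmul => /andP[uz _].
  by apply: tmor_extl sg; rewrite teq_sym.
rewrite le_tmul ru (le_trans rg (tmor_lel _ _ _)); split=> //.
apply: (tmor_comp_intro rg); rewrite le_tmul (le_trans rg (tmor_lel _ _ _)).
exact: le_trans ru (teq_lel _ _).
Qed.

(* A morphism to [B] defined on the part of [A] of extent [pext]. *)
Record partial_mor (A B : tset T) := PartialMor {
  pext : {i01 R};
  pfun :> A -> B -> {i01 R};
  pfun_ext : forall a b, pfun a b <= pext;
  pfun_lel : forall a b, pfun a b <= teq a a;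
  pfun_ler : forall a b, pfun a b <= teq b b;
  pfun_extl : forall a a' b r, r <= teq a a' -> r <= pfun a b -> r <= pfun a' b;
  pfun_extr : forall a b b' r, r <= teq b b' -> r <= pfun a b -> r <= pfun a b';
  pfun_sv : forall a b b' r, r <= pfun a b -> r <= pfun a b' -> r <= teq b b';
  pfun_tot : forall a, pext * teq a a <= Isup [set pfun a b | b in [set: B]];
}.

(** * Exponentials as sets of partial morphisms *)

Section Exponential.
Variables A B : tset T.
Implicit Types f g : partial_mor A B.

(** The last clause says that [f a b] and [g a b] have the same meet with [r]. *)
Definition pmor_agree f g r := [/\ r <= pext f, r <= pext g &
  forall a b s, s <= r -> (s <= f a b) = (s <= g a b)].

Definition pmor_eq f g : {i01 R} := Isup [set r | pmor_agree f g r].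

(** Agreement passes to smaller stages, and by [Isup_elim] it may be tested on the members of the
    join; so the join of the stages of agreement is itself one. *)
Lemma pmor_eqP f g r : r <= pmor_eq f g <-> pmor_agree f g r.
Proof.
split=> [rfg|]; last by move=> ?; exact: Isup_ub.
have sub q s : pmor_agree f g q -> s <= q -> pmor_agree f g s.
  move=> [qf qg fg] sq; split; [exact: le_trans qf|exact: le_trans qg|].
  by move=> a b s' s's; apply: fg; exact: le_trans sq.
split.
- by apply: Isup_elim rfg => q s /sub fg _ /fg[].
- by apply: Isup_elim rfg => q s /sub fg _ /fg[].
- move=> a b s sr; apply/idP/idP => le_s.
    apply: Isup_elim (le_trans sr rfg) => q s' /sub fg s's /fg[_ _ <- //].
    exact: le_trans le_s.
  apply: Isup_elim (le_trans sr rfg) => q s' /sub fg s's /fg[_ _ -> //].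
  exact: le_trans le_s.
Qed.

Definition tset_exp : tset T.
Proof.
apply: (@tset_idem (partial_mor A B) pmor_eq).
- move=> f g; have [ff _ _] := (pmor_eqP f g _).1 (lexx _).
  by apply/pmor_eqP; split.
- move=> f g; congr Isup; apply/seteqP.
  by split=> r [rf rg fg]; split=> // a b s sr; rewrite fg.
- move=> f g h r /pmor_eqP[rf rg fg] /pmor_eqP[_ rh gh]; apply/pmor_eqP.
  by split=> // a b s sr; rewrite fg // gh.
Defined.

Lemma tset_exp_ext (f : tset_exp) : teq f f = pext f.
Proof.
apply/le_anti/andP; split; first by have [] := (pmor_eqP f f _).1 (lexx _).
by apply/pmor_eqP; split.
Qed.

Definition tmor_ev : tmor (tset_prod tset_exp A) B.
Proof.
apply: (@tmor_idem (tset_prod tset_exp A) B (fun u b => pfun u.1 u.2 b)).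
- by move=> u b; rewrite tset_prod_eq tset_exp_ext pfun_ext pfun_lel.
- by move=> u b; exact: pfun_ler.
- move=> u v b r; rewrite tset_prod_eq => /andP[/pmor_eqP[_ _ uv1] uv2].
  by rewrite uv1 // => ru; exact: pfun_extl uv2 ru.
- by move=> u b b' r; exact: pfun_extr.
- by move=> u b b' r; exact: pfun_sv.
- move=> u; apply: le_trans (pfun_tot u.1 u.2).
  by rewrite -tset_exp_ext.
Defined.

Definition tmor_slice (Z : tset T) (f : tmor (tset_prod Z A) B) (z : Z) :
  partial_mor A B.
Proof.
apply: (@PartialMor A B (teq z z) (fun a b => f (z, a) b)).
- by move=> a b; apply: (le_trans (tmor_lel _ _ _)); exact: tmul_lel.
- by move=> a b; apply: (le_trans (tmor_lel _ _ _)); exact: tmul_ler.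
- by move=> a b; exact: tmor_ler.
- move=> a a' b r aa' rf; apply: tmor_extl (rf); rewrite tset_prod_eq aa' andbT.
  by apply: (le_trans rf); apply: (le_trans (tmor_lel _ _ _)); exact: tmul_lel.
- by move=> a b b' r; exact: tmor_extr.
- by move=> a b b' r; exact: tmor_sv_idem.
- by move=> a; exact: (tmor_tot_le f (z, a)).
Defined.

Lemma tmor_slice_eq (Z : tset T) (f : tmor (tset_prod Z A) B) (z z' : Z) :
  teq z z' <= @teq _ _ tset_exp (tmor_slice f z) (tmor_slice f z').
Proof.
apply/pmor_eqP; split=> [||a b s sz]; [exact: teq_lel|exact: teq_ler|].
by apply/idP/idP => sf; apply: tmor_extl (sf);
  rewrite tset_prod_eq ?(teq_sym z') sz; apply: (le_trans sf);
  apply: (le_trans (tmor_lel _ _ _)); exact: tmul_ler.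
Qed.

Definition tmor_curry (Z : tset T) (f : tmor (tset_prod Z A) B) :
  tmor Z tset_exp :=
  tmor_of (fun z => tset_exp_ext (tmor_slice f z)) (tmor_slice_eq f).

Lemma tmor_ev_exponential :
  @is_exponential C tset_products A B tset_exp tmor_ev.
Proof.
move=> Z f; exists (tmor_curry f); split.
  apply: tmor_le_eq => -[z a] b.
  apply: tmor_comp_elim (lexx _) => -[h a'] s _ sh.
  rewrite cprod_maplE /= => /andP[/pmor_eqP[_ _ fh] aa'].
  by rewrite (fh a b) //; apply: pfun_extl sh; rewrite teq_sym.
(* By [tmor_le_eq] it is enough that [h] agrees, wherever [g z h] holds, with the slice at [z] of
   the evaluated [g]; single-valuedness of [g] identifies [h] with any other value [h'] met
   there. *)
move=> g <-; apply/esym/tmor_le_eq => z h; apply/pmor_eqP.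
split; first exact: tmor_lel.
  by rewrite -tset_exp_ext; exact: tmor_ler.
move=> a b s sg; apply/idP/idP => le_s.
  apply: tmor_comp_elim le_s => -[h' a'] s' s's sh'.
  rewrite cprod_maplE /= => /andP[sg' aa'].
  have /pmor_eqP[_ _ <- //] := tmor_sv_idem sg' (le_trans s's sg).
  by apply: pfun_extl sh'; rewrite teq_sym.
rewrite -[leRHS]/(tmor_comp tmor_ev (cprod_mapl tset_products A g) (z, a) b).
apply: (@tmor_comp_intro _ (tset_prod tset_exp A) _ _ _ _ (h, a)) => //.
rewrite cprod_maplE sg.
exact: le_trans le_s (pfun_lel _ _ _).
Qed.

End Exponential.

Lemma idem_cartesian_closed : cartesian_closed C.
Proof.
exists tset_products => A B; exists (tset_exp A B), (tmor_ev A B).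
exact: tmor_ev_exponential.
Qed.

End IdempotentCartesianClosed.

Theorem theorem3p8 (R : realType) (T : lc_tnorm R) :
  cartesian_closed (tset_category T) <->
  (forall p q : {i01 R}, tmul T p q = Order.min p q).
Proof.
split=> [/cartesian_closed_idem idem p q|Tmin].
  apply/le_anti; rewrite le_min tmul_lel tmul_ler /=.
  (* The minimum is its own square, hence at most [p * q]. *)
  by rewrite -[leLHS]idem; apply: tmul_mono; rewrite ge_min lexx ?orbT.
by apply: idem_cartesian_closed => p; rewrite Tmin minxx.
Qed.
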